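(* Let $(A,B,C)\in\mathbb R^3$ with $(A,B)\ne(0,0)$, and let $I\subseteq\widehat{\mathbb R}$ be the subinterval of the projectively extended reals $I=\{t\in\widehat{\mathbb R}: At^2+Bt+C>0\}$. For $\Delta>0$ set $$W_\Delta^{(A,B,C)}=\Big\{\frac mn : m,n\in\mathbb Z,\ n\ge1,\ \gcd(m,n)=1,\ 0<Am^2+Bmn+Cn^2\le\Delta\Big\}.$$ Then, as $\Delta\to\infty$, $W_\Delta^{(A,B,C)}$ is equidistributed over $I$ with respect to the measure $d\mu=\frac{1}{At^2+Bt+C}\,dt$; that is, for all compact subintervals $I_1\subseteq I_2\subseteq I$ with $\mu(I_2)\neq0$, $$\lim_{\Delta\to\infty}\frac{\#\,(I_1\cap W_\Delta^{(A,B,C)})}{\#\,(I_2\cap W_\Delta^{(A,B,C)})}=\frac{\mu(I_1)}{\mu(I_2)}.$$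
   Context: $\widehat{\mathbb R}=\mathbb R\cup\{\infty\}$ is the projectively extended real line (a circle, with $\infty=-\infty$). Subintervals of $\widehat{\mathbb R}$ are allowed to wrap around through $\infty$. Convention on the point $\infty$: $\infty\in I$ if and only if $A>0$. Explicitly, with $D=B^2-4AC$: - if $A=0,B>0$: $I=(-C/B,\infty)$; - if $A=0,B<0$: $I=(-\infty,-C/B)$; - if $A>0,D>0$: $I=(\frac{-B+\sqrt D}{2A},\infty]\cup[-\infty,\frac{-B-\sqrt D}{2A})$, wrapping around through $\infty$; - if $A>0,D<0$: $I=[-\infty,\infty]=\widehat{\mathbb R}$; - if $A>0,D=0$: $I=(\frac{-B}{2A},\infty]\cup[-\infty,\frac{-B}{2A})$, wrapping around through $\infty$; - if $A<0,D>0$: $I=(\frac{-B+\sqrt D}{2A},\frac{-B-\sqrt D}{2A})$; - if $A<0$, $D\le0$: $I$ is empty and the assertion is vacuous. The measure $\mu$ gives the point $\infty$ mass $0$. *)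

(* Defs.v *)
From HB Require Import structures.
From mathcomp Require Import all_boot all_order all_algebra finmap.
From mathcomp Require Import all_classical all_reals all_analysis.

Set Implicit Arguments.
Unset Strict Implicit.
Unset Printing Implicit Defensive.

Import Order.TTheory GRing.Theory Num.Theory.
Import numFieldNormedType.Exports.

Local Open Scope classical_set_scope.
Local Open Scope ring_scope.

(* [None] is the point oo = -oo, [Some t] the real number t; the topology is
   that of a circle. *)
Definition projR (R : realType) : topologicalType :=
  one_point_compactification R.

(* The intervals of the circle, including those that wrap around through oo
   and the circle itself, are its connected subsets. *)
Definition compact_subinterval (R : realType) (J : set (projR R)) : Prop :=
  compact J /\ connected J.

Definition quad (R : realType) (A B C t : R) : R := A * t ^+ 2 + B * t + C.

(* At oo the sign of the quadratic is by convention that of A. *)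
Definition pos_interval (R : realType) (A B C : R) : set (projR R) :=
  [set x | match x with Some t => 0 < quad A B C t | None => 0 < A end].

Definition W (R : realType) (A B C Delta : R) : set (projR R) :=
  [set x | exists m n : int,
     [/\ (1 <= n)%R, gcdz m n = 1,
         0 < A * m%:~R ^+ 2 + B * m%:~R * n%:~R + C * n%:~R ^+ 2 <= Delta
       & x = Some (m%:~R / n%:~R)]].

(* dmu = dt / (A t^2 + B t + C), with mu {oo} = 0; only meaningful for
   J `<=` pos_interval A B C, where the density is positive. *)
Definition mu (R : realType) (A B C : R) (J : set (projR R)) : \bar R :=
  (\int[@lebesgue_measure R]_(t in Some @^-1` J) ((quad A B C t)^-1)%:E)%E.

(* [fset_set] is the finite set underlying a finite classical set (and the
   empty one for an infinite set). *)
Definition ncard (R : realType) (X : set (projR R)) : nat := #|` fset_set X|.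

Definition equidistributed (R : realType) (V : R -> set (projR R))
    (I : set (projR R)) (nu : set (projR R) -> \bar R) : Prop :=
  forall I1 I2 : set (projR R),
    compact_subinterval I1 -> compact_subinterval I2 ->
    I1 `<=` I2 -> I2 `<=` I -> nu I2 <> 0%E ->
    (ncard (I1 `&` V Delta))%:R / (ncard (I2 `&` V Delta))%:R
      @[Delta --> +oo] --> fine (nu I1) / fine (nu I2).

(* Main.v *)
(* Write q t = A t^2 + B t + C, S for the real part of a compact subinterval J
   of I, and t^2 for Delta.  By compactness q u >= c (1 + u^2) on S.  Counting
   the pairs (m, n) with n >= 1, m/n in S and n^2 q(m/n) <= t^2, coprime or not,
   line by line, gives up to O(t) the sum over n of n times the length of
   {u in S : q u <= t^2/n^2}, that is the integral over S of N(N+1)/2 with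
   N = floor (t / sqrt (q u)); by dominated convergence the count L(t) satisfies
   L(t) / t^2 --> mu J / 2, also when J passes through oo.

   Let P(t) count the coprime pairs, so that L(t) = sum_(d >= 1) P(t / d).  The
   function f = mu I2 * P1 - mu I1 * P2 satisfies sum_(d >= 1) f(t / d) = o(t^2);
   as sum_(d >= 2) 1/d^2 <= 3/4 < 1, this forces f = o(t^2), without Moebius
   inversion or the value of zeta(2).  The same inequality bounds P2(t) / t^2
   away from 0. *)

Require Import Defs.
From HB Require Import structures.
From mathcomp Require Import all_boot all_order all_algebra finmap.
From mathcomp Require Import all_classical all_reals all_analysis.
From mathcomp Require Import measurable_realfun ring lra zify.

Set Implicit Arguments.
Unset Strict Implicit.
Unset Printing Implicit Defensive.

Import Order.TTheory GRing.Theory Num.Theory.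
Import numFieldNormedType.Exports.

Local Open Scope classical_set_scope.
Local Open Scope ring_scope.

(** * Compact subintervals of the circle *)

Section Circle.
Context {R : realType}.
Implicit Types (J : set (projR R)) (S : set R) (A B C : R).

(** The growth like 1 + u^2, rather than a constant lower bound, is what makes sublevel sets bounded
    and 1/q integrable even when S is unbounded, as for arcs through oo. *)
Definition coercive A B C S :=
  exists2 c : R, 0 < c & forall u, S u -> c * (1 + u ^+ 2) <= quad A B C u.

Definition homogenized A B C (x : projR R) : R :=
  if x is Some u then quad A B C u / (1 + u ^+ 2) else A.

Lemma oneDsqr_pos (u : R) : 0 < 1 + u ^+ 2.
Proof. by rewrite ltr_pwDl// sqr_ge0. Qed.

Lemma quad_continuous A B C : continuous (quad A B C).
Proof.
move=> u; rewrite /quad; apply: cvgD; last exact: cvg_cst.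
by apply: cvgD; apply: cvgM;
  [exact: cvg_cst|exact: exprn_continuous|exact: cvg_cst|exact: cvg_id].
Qed.

Lemma homogenized_continuous A B C : continuous (homogenized A B C).
Proof.
case=> [u|].
  apply/cvgrPdist_lt => e e0.
  have /cvgrPdist_lt/(_ e e0) :
      (fun v : R => quad A B C v / (1 + v ^+ 2)) v @[v --> u] -->
      quad A B C u / (1 + u ^+ 2).
    apply: cvgM; first exact: quad_continuous.
    exact: (@continuous_oneDsqrV R u).
  by move/one_point_compactification_some_nbhs; apply: filterS => _ [v + <-].
apply/(@cvgrPdist_lt _ _ _ _ (nbhs_filter (None : projR R))) => e e0.
(* For |u| > M >= 1 the difference is at most (|B| + |C - A|) |u| / (1 + u^2), hence less than e M
   |u| / (1 + u^2) < e. *)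
pose M := (`|B| + `|C - A|) / e + 1.
have M1 : 1 <= M by rewrite lerDr divr_ge0// ?addr_ge0// ltW.
exists `[- M, M]%classic; first by split; [exact: segment_compact|exact: itv_closed].
move=> _ [[u /= /negP uM <-]|->]/=; last by rewrite subrr normr0.
have {}uM : M < `|u|.
  by rewrite ltNge ler_norml; apply: contra uM; rewrite in_itv.
have u1 : 1 < `|u| by exact: le_lt_trans uM.
have -> : A - quad A B C u / (1 + u ^+ 2) = - (B * u + (C - A)) / (1 + u ^+ 2).
  by rewrite /quad; field; rewrite gt_eqF// oneDsqr_pos.
rewrite normrM normrN normfV (gtr0_norm (oneDsqr_pos u)) ltr_pdivrMr ?oneDsqr_pos//.
have eM : `|B| + `|C - A| < e * M by rewrite /M mulrDr mulrCA divff ?gt_eqF// !mulr1 ltrDl.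
apply: (@le_lt_trans _ _ ((`|B| + `|C - A|) * `|u|)).
  rewrite mulrDl (le_trans (ler_normD _ _))// normrM lerD2l.
  by rewrite ler_peMr// ltW.
apply: (@lt_trans _ _ (e * M * `|u|)); first by rewrite ltr_pM2r// (lt_trans _ u1).
rewrite -mulrA ltr_pM2l// (@lt_trans _ _ (`|u| * `|u|))//.
  by rewrite ltr_pM2r// (lt_trans _ u1).
by rewrite -normrM -expr2 ger0_norm ?sqr_ge0// ltrDr.
Qed.

(* On a compact part of the circle where the form is positive,
   [homogenized A B C], which is the form restricted to the unit circle, stays
   away from zero. *)
Lemma compact_coercive A B C J : compact J -> J `<=` pos_interval A B C ->
  coercive A B C (Some @^-1` J).
Proof.
move=> cJ JI.
have cF : closed (homogenized A B C @` J).
  apply: compact_closed; first exact: Rhausdorff.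
  apply: continuous_compact => //; apply: continuous_subspaceT.
  exact: homogenized_continuous.
have pos x : J x -> 0 < homogenized A B C x.
  move=> /JI; case: x => //= u qu.
  by rewrite divr_gt0 ?oneDsqr_pos.
have nF : (~` (homogenized A B C @` J)) 0.
  by move=> [x /pos + x0]; rewrite x0 ltxx.
have /nbhs_ballP[e /= e0 eF] : nbhs (0 : R) (~` (homogenized A B C @` J)).
  by apply: open_nbhs_nbhs; split => //; exact: closed_openC.
(* The radius of a ball around 0 that misses the compact image serves as the coercivity constant. *)
exists e => // u Ju; rewrite -ler_pdivlMr ?oneDsqr_pos// leNgt; apply/negP => lt_e.
have /= := pos _ Ju => q0.
apply: (eF (quad A B C u / (1 + u ^+ 2))); last by exists (Some u).
by rewrite /ball/= sub0r normrN gtr0_norm.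
Qed.

(** If convexity failed, an open real interval would cut out a nonempty, proper and relatively
    clopen part of J: the ray below a missing point c when oo is outside J, the interval between two
    missing points a and b when oo is in J. *)
Lemma connected_interval J : connected J ->
  (~ J None -> is_interval (Some @^-1` J)) /\
  (J None -> is_interval (~` (Some @^-1` J))).
Proof.
move=> cJ; split=> JN.
  apply/is_intervalPlt => a b Ja Jb c /andP[ac cb]; apply: contrapT => Jc.
  pose D : set (projR R) := Some @` [set` `]-oo, c[].
  have : J `&` D = J.
    apply: cJ.
    - by exists (Some a); split=> //; exists a => //=; rewrite in_itv.
    - by exists D => //; exact: one_point_compactification_open_some.
    exists (~` (Some @` [set` `]c, +oo[])).
      by apply: open_closedC; exact: one_point_compactification_open_some.
    apply/seteqP; split=> -[u|] [Ju]//=.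
      move=> [v + [vu]]; rewrite vu /= in_itv/= => vc; split => //.
      by move=> [w + [wu]]; rewrite wu /= in_itv/= andbT => /(lt_trans vc); rewrite ltxx.
    move=> cu; split => //; exists u => //=; rewrite in_itv/=.
    case: (ltgtP u c) => // [uc|uc]; last by rewrite uc in Ju.
    by exfalso; apply: cu; exists u => //=; rewrite in_itv/= andbT.
  move/seteqP => [_ /(_ _ Jb)[_ [v + [vb]]]].
  by rewrite vb /= in_itv/= => /(lt_trans cb); rewrite ltxx.
apply/is_intervalPlt => a b Ja Jb c /andP[ac cb] Jc.
pose D : set (projR R) := Some @` [set` `]a, b[].
have : J `&` D = J.
  apply: cJ.
  - by exists (Some c); split=> //; exists c => //=; rewrite in_itv/= ac.
  - by exists D => //; exact: one_point_compactification_open_some.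
  (* This closed set is the image of [a, b]; it meets J in the same points as D because a and b are
     missing from J. *)
  exists (~` ((Some @` (~` [set` `[a, b]])) `|` [set None])); last first.
    apply/seteqP; split=> -[u|] [Ju]//=.
    - move=> [v + [vu]]; rewrite vu /= in_itv/= => /andP[au ub]; split => //.
      by move=> [|//] [w + [wu]]; rewrite wu /= in_itv/= !ltW.
    - by case.
    - move=> /not_orP[H _]; split => //; exists u => //.
      have : u \in `[a, b].
        by apply: contrapT => abu; apply: H; exists u.
      rewrite /= !in_itv/= => /andP[]; rewrite !le_eqVlt.
      move=> /predU1P[au|->]; first by rewrite au in Ja.
      by move=> /predU1P[ub|->//]; rewrite -ub in Jb.
    - by move=> /not_orP[_ []].
  apply: open_closedC; rewrite openE => -[u [|//] [v abv [<-]]|_] /=.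
    rewrite /interior/=; apply: filterS (_ : nbhs _ (Some @` (~` [set` `[a, b]]))).
      by move=> x; left.
    apply: one_point_compactification_some_nbhs; apply: open_nbhs_nbhs; split => //.
    by apply: closed_openC; exact: itv_closed.
  by exists `[a, b]%classic => //; split; [exact: segment_compact|exact: itv_closed].
by move/seteqP => [_ /(_ _ JN)[_ []]].
Qed.

End Circle.

(** * Sums over dilates *)

Section Dilates.
Context {R : realType}.
Implicit Types (f : R -> R) (K t e theta T : R) (D M d : nat).

(** Telescoping, since 1/(d+1)^2 <= 1/d - 1/(d+1). *)
Lemma sum_invsqr_tail D M : (0 < D)%N ->
  \sum_(D <= d < M) (d.+1%:R ^- 2 : R) <= D%:R^-1.
Proof.
move=> D0; have [MD|DM] := leqP M D.
  by rewrite big_geq// invr_ge0 ler0n.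
suff /le_trans : \sum_(D <= d < M) (d.+1%:R ^- 2 : R) <= D%:R^-1 - M%:R^-1.
  by apply; rewrite gerBl invr_ge0 ler0n.
have := ltnW DM; elim: {DM} M => [|M IH]; first by rewrite leqNgt D0.
rewrite leq_eqVlt => /predU1P[->|]; first by rewrite big_geq// subrr.
rewrite ltnS => DM; rewrite big_nat_recr//=.
apply: le_trans (lerD (IH DM) (lexx _)) _.
have M0 : (0 : R) < M%:R by rewrite ltr0n (leq_trans D0).
have M10 : (0 : R) < M.+1%:R by rewrite ltr0n.
have -> : (M.+1%:R : R) = M%:R + 1 by rewrite -natr1.
have {}M10 : (0 : R) < M%:R + 1 by rewrite natr1.
rewrite -addrA lerD2l -subr_ge0.
have -> : - (M%:R + 1)^-1 - (- M%:R^-1 + (M%:R + 1) ^- 2) =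
  M%:R^-1 * (M%:R + 1) ^- 2 :> R by field; rewrite !gt_eqF.
by rewrite mulr_ge0// invr_ge0 ?exprn_ge0// ltW.
Qed.

(** The first term is 1/4 and the tail from d = 2 is at most 1/2. What matters later is that the
    total stays below 1. *)
Lemma sum_invsqr_le M : \sum_(1 <= d < M) (d.+1%:R ^- 2 : R) <= 3 / 4.
Proof.
have [M1|M1] := leqP M 1; first by rewrite big_geq//; lra.
rewrite big_ltn//; have := @sum_invsqr_tail 2 M isT.
by set s := \sum_(_ <= _ < _) _ => ?; lra.
Qed.

(** For d < D the argument t/(d+1) is still at least T, so the bound theta applies and contributes
    3/4 theta; for d >= D only the crude bound K is available, and the tail costs K/D <= e. *)
Lemma sum_dilates_le f K theta e T : 0 <= K -> 0 <= theta -> 0 < e ->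
  (forall t, 0 < t -> `|f t| <= K * t ^+ 2) ->
  (forall t, T <= t -> `|f t| <= theta * t ^+ 2) ->
  exists T', forall t, T' <= t -> forall M,
    \sum_(1 <= d < M) `|f (t / d.+1%:R)| <= (3 / 4 * theta + e) * t ^+ 2.
Proof.
move=> K0 theta0 e0 fK ftheta.
pose D := (Num.trunc (K / e)).+1.
have KD : K * D%:R^-1 <= e.
  by rewrite ler_pdivrMr ?ltr0n// mulrC -ler_pdivrMr// ltW// truncnS_gt.
exists (Num.max T 1 * D%:R) => t Tt M.
have t0 : 0 < t.
  by rewrite (lt_le_trans _ Tt)// mulr_gt0 ?ltr0n// lt_max ltr01 orbT.
have tE d : (t / d.+1%:R) ^+ 2 = t ^+ 2 * d.+1%:R ^- 2 by rewrite exprMn exprVn.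
have small d : (d < D)%N -> `|f (t / d.+1%:R)| <= theta * t ^+ 2 * d.+1%:R ^- 2.
  move=> dD; rewrite -mulrA -tE ftheta// ler_pdivlMr ?ltr0n//.
  apply: le_trans Tt; apply: (@le_trans _ _ (Num.max T 1 * d.+1%:R)).
    by rewrite ler_pM2r ?ltr0n// le_max lexx.
  by rewrite ler_wpM2l ?ler_nat// le_max ler01 orbT.
have large d : `|f (t / d.+1%:R)| <= K * t ^+ 2 * d.+1%:R ^- 2.
  by rewrite -mulrA -tE fK// divr_gt0// ltr0n.
have inv0 d : 0 <= (d.+1%:R ^- 2 : R) by rewrite invr_ge0 exprn_ge0.
have first_part N : (N <= D)%N ->
    \sum_(1 <= d < N) `|f (t / d.+1%:R)| <= 3 / 4 * theta * t ^+ 2.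
  move=> ND; apply: (@le_trans _ _ (\sum_(1 <= d < N) theta * t ^+ 2 * d.+1%:R ^- 2)).
    by rewrite !big_nat ler_sum// => d /andP[_ dN]; rewrite small// (leq_trans dN).
  have -> : 3 / 4 * theta * t ^+ 2 = theta * t ^+ 2 * (3 / 4) by ring.
  rewrite -mulr_sumr; apply: ler_wpM2l (sum_invsqr_le N).
  by rewrite mulr_ge0// sqr_ge0.
have [MD|DM] := leqP M D.
  by rewrite (le_trans (first_part _ MD))// ler_wpM2r ?sqr_ge0// lerDl ltW.
rewrite (@big_cat_nat _ _ _ D)//=; last exact: ltnW.
rewrite mulrDl lerD ?first_part//.
apply: (@le_trans _ _ (\sum_(D <= d < M) K * t ^+ 2 * d.+1%:R ^- 2)).
  by apply: ler_sum => d _; exact: large.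
rewrite -mulr_sumr mulrAC ler_wpM2r ?sqr_ge0//.
by apply: le_trans KD; rewrite ler_wpM2l// sum_invsqr_tail.
Qed.

(* Isolating the term d = 0 and bounding the others by [sum_dilates_le] turns
   a bound theta for |f t| / t^2 near +oo into the bound 7/8 theta. *)
Lemma small_of_sum_dilates f K : 0 <= K ->
  (forall t, 0 < t -> `|f t| <= K * t ^+ 2) ->
  (forall e, 0 < e -> exists T, forall t, T <= t ->
    exists2 M, (0 < M)%N & `|\sum_(0 <= d < M) f (t / d.+1%:R)| <= e * t ^+ 2) ->
  forall e, 0 < e -> exists T, forall t, T <= t -> `|f t| <= e * t ^+ 2.
Proof.
move=> K0 fK fsum e e0.
have step k : exists T, forall t, T <= t ->
    `|f t| <= ((7 / 8) ^+ k * (K + 1)) * t ^+ 2.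
  elim: k => [|k [T IH]].
    exists 1 => t t1; rewrite expr0 mul1r (le_trans (fK _ _)) ?(lt_le_trans _ t1)//.
    by rewrite ler_wpM2r ?sqr_ge0// lerDl.
  set theta := (7 / 8) ^+ k * (K + 1) in IH.
  have theta0 : 0 < theta by rewrite mulr_gt0 ?exprn_gt0 ?ltr_wpDl//; lra.
  (* The complete sum costs theta/16 and its terms with d >= 1 cost 3/4 theta + theta/16, which adds
     up to 7/8 theta. *)
  have theta16 : 0 < theta / 16 by lra.
  have [T1 H1] := sum_dilates_le K0 (ltW theta0) theta16 fK IH.
  have [T2 H2] := fsum _ theta16.
  exists (Num.max T1 T2) => t; rewrite ge_max => /andP[/H1{}H1 /H2[M M0 H]].
  have -> : f t = \sum_(0 <= d < M) f (t / d.+1%:R) -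
                  \sum_(1 <= d < M) f (t / d.+1%:R).
    by rewrite big_ltn// divr1 addrK.
  rewrite (le_trans (ler_normB _ _))//.
  have -> : (7 / 8) ^+ k.+1 * (K + 1) * t ^+ 2 =
      theta / 16 * t ^+ 2 + (3 / 4 * theta + theta / 16) * t ^+ 2.
    by rewrite exprS -(mulrA (7 / 8)) -/theta; field.
  rewrite lerD// (le_trans _ (H1 M))//; exact: ler_norm_sum.
have : (7 / 8) ^+ k * (K + 1) @[k --> \oo] --> (0 : R).
  rewrite -[X in _ --> X](mul0r (K + 1)); apply: cvgM; last exact: cvg_cst.
  by apply: cvg_expr; rewrite ger0_norm; lra.
move=> /cvgrPdist_le/(_ _ e0)[N _ /(_ N (leqnn N))] /=.
rewrite sub0r normrN => He; have [T HT] := step N.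
exists T => t Tt; apply: le_trans (HT _ Tt) _.
by rewrite ler_wpM2r ?sqr_ge0// (le_trans (ler_norm _)).
Qed.

End Dilates.

(** * Fractions with a given denominator in an interval *)

(** The analogue of [ncard] on any choice type. It is 0 on infinite sets, hence the finiteness
    conditions below. *)
Definition card_set (T : choiceType) (X : set T) : nat := #|` fset_set X|.

Section Card.
Context {T U : choiceType}.
Implicit Types X Y : set T.

Lemma card_set_image (f : T -> U) X : finite_set X ->
  {in X &, injective f} -> card_set (f @` X) = card_set X.
Proof.
move=> fX fi; rewrite /card_set fset_set_image// card_in_imfset//= => x y.
by rewrite !in_fset_set//; exact: fi.
Qed.

Lemma le_card_set X Y : finite_set Y -> X `<=` Y -> (card_set X <= card_set Y)%N.
Proof.
move=> fY XY; have fX := sub_finite_set XY fY.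
by apply: fsubset_leq_card; rewrite -fset_set_sub.
Qed.

Lemma card_setID X Y : finite_set X ->
  card_set X = (card_set (X `&` Y) + card_set (X `\` Y))%N.
Proof.
move=> fX; have fI : finite_set (X `&` Y) by exact: finite_setIl.
rewrite /card_set.
have -> : fset_set X = (fset_set (X `&` Y) `|` fset_set (X `\` Y))%fset.
  by rewrite -fset_setU ?setUIDK//; exact: finite_setD.
rewrite cardfsU -fset_setI//; last exact: finite_setD.
suff -> : (X `&` Y) `&` (X `\` Y) = set0 by rewrite fset_set0 cardfs0 subn0.
by rewrite -subset0 => x [[_ Yx] [_]].
Qed.

Lemma card_set_bigcup (F : nat -> set T) M : (forall i, finite_set (F i)) ->
  trivIset setT F ->
  card_set (\bigcup_(i < M) F i) = (\sum_(0 <= i < M) card_set (F i))%N.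
Proof.
by move=> fF tF; rewrite /card_set bigcup_mkord -trivIset_sum_card// big_mkord.
Qed.

End Card.

Section IntervalCount.
Context {R : realType}.
Implicit Types (K S : set R) (a b r u : R) (n : nat).

Definition lam K : R := fine (@lebesgue_measure R K).

Lemma lebesgue_measure_segment a b : a <= b ->
  @lebesgue_measure R `[a, b]%classic = (b - a)%:E.
Proof.
rewrite lebesgue_measure_itv/= lte_fin le_eqVlt => /predU1P[->|->//].
by rewrite ltxx subrr.
Qed.

Lemma lebesgue_measure_bounded K a b : measurable K -> K `<=` `[a, b] ->
  @lebesgue_measure R K \is a fin_num.
Proof.
move=> mK Kab; rewrite ge0_fin_numE//.
apply: (@le_lt_trans _ _ (lebesgue_measure `[a, b]%classic)).
  by apply: le_measure => //; rewrite inE.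
by rewrite lebesgue_measure_itv/=; case: ifP => _; exact: ltry.
Qed.

Lemma lam_le K a b : measurable K -> a <= b -> K `<=` `[a, b] -> lam K <= b - a.
Proof.
move=> mK ab Kab; rewrite /lam -[leRHS]/(fine (b - a)%:E) -lebesgue_measure_segment//.
apply: fine_le; first exact: lebesgue_measure_bounded Kab.
- by rewrite lebesgue_measure_segment.
- by apply: le_measure => //; rewrite inE.
Qed.

Lemma lam_ge K a b c d : measurable K -> a <= b -> `[a, b] `<=` K ->
  K `<=` `[c, d] -> b - a <= lam K.
Proof.
move=> mK ab abK Kcd; rewrite /lam -[leLHS]/(fine (b - a)%:E) -lebesgue_measure_segment//.
apply: fine_le; last by apply: le_measure => //; rewrite inE.
- by rewrite lebesgue_measure_segment.
- exact: lebesgue_measure_bounded Kcd.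
Qed.

Definition fractions K n : set int := [set m | K (m%:~R / n.+1%:R)].

Lemma bounded_fractions K r : K `<=` `[- r, r] -> forall n,
  exists N : nat, forall m : int, fractions K n m -> - N%:Z <= m <= N%:Z.
Proof.
move=> Kr n; pose N := (Num.trunc (r * n.+1%:R)).+1; exists N => m /Kr.
have rN : r * n.+1%:R <= N%:~R by rewrite -pmulrn ltW// truncnS_gt.
rewrite /= in_itv/= ler_pdivlMr ?ltr0n// ler_pdivrMr ?ltr0n// => /andP[rm mr].
rewrite -!(ler_int R) rmorphN/= (le_trans mr rN) andbT.
by rewrite (le_trans _ rm)// mulNr lerN2.
Qed.

Lemma finite_fractions K n r : K `<=` `[- r, r] -> finite_set (fractions K n).
Proof.
move=> /bounded_fractions/(_ n)[N HN].
apply: (@sub_finite_set _ _ ((fun i : nat => i%:Z - N%:Z) @` `I_(N + N).+1)).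
  by move=> m /HN ?; exists (absz (m + N%:Z)); rewrite /=; lia.
by apply: finite_image; exact: finite_II.
Qed.

(** Write n for the denominator. The numerators run through consecutive integers i, ..., j; K
    contains [i/n, j/n] and lies in [(i-1)/n, (j+1)/n], so n times its length is within 1 of j - i +
    1. If there is no numerator, K lies between two consecutive multiples of 1/n. *)
Lemma card_fractions K n r : is_interval K -> K `<=` `[- r, r] ->
  `|(card_set (fractions K n))%:R - n.+1%:R * lam K| <= 1.
Proof.
move=> iK Kr; have mK : measurable K by exact: is_interval_measurable.
have n0 : (0 : R) < n.+1%:R by rewrite ltr0n.
have [N HN] := bounded_fractions Kr n.
have lam0 : 0 <= lam K by exact: fine_ge0.
have [[m Xm]|noX] := pselect (exists m, fractions K n m); last first.
  have -> : fractions K n = set0 by rewrite -subset0 => m Km; apply: noX; exists m.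
  rewrite /card_set fset_set0 cardfs0 sub0r normrN ger0_norm ?mulr_ge0 ?ler0n//.
  rewrite -ler_pdivlMl// mulr1.
  have [[u Ku]|K0] := pselect (exists u, K u); last first.
    rewrite (_ : K = set0); last by rewrite -subset0 => m Km; apply: K0; exists m.
    by rewrite /lam measure0 /= invr_ge0 ltW.
  pose j := Num.floor (u * n.+1%:R).
  have ju : j%:~R / n.+1%:R <= u by rewrite ler_pdivrMr// floor_le_tmp.
  have uj : u < (j + 1)%:~R / n.+1%:R by rewrite ltr_pdivlMr// floorD1_gt.
  have -> : n.+1%:R^-1 = (j + 1)%:~R / n.+1%:R - j%:~R / n.+1%:R :> R.
    by rewrite -mulrBl rmorphD/= addrAC subrr add0r mul1r.
  apply: lam_le => //; first by rewrite (le_trans ju)// ltW.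
  move=> v Kv; rewrite /= in_itv/= !leNgt; apply/andP; split; apply/negP => vj.
    by apply: noX; exists j; apply: (iK v u) => //; rewrite ju ltW.
  by apply: noX; exists (j + 1); apply: (iK u v) => //; rewrite !ltW.
(* Shifting by N moves the numerators into the naturals, where a least and a greatest one can be
   extracted. *)
pose P k := `[< fractions K n (k%:Z - N%:Z) >].
have PX m' : fractions K n m' -> exists2 k, P k & m' = k%:Z - N%:Z.
  move=> Xm'; have := HN _ Xm' => mN.
  have E : m' = (absz (m' + N%:Z))%:Z - N%:Z by lia.
  by exists (absz (m' + N%:Z)) => //; apply/asboolP; rewrite -E.
have exP : exists k, P k by have [k Pk _] := PX _ Xm; exists k.
have ubP k : P k -> (k <= N + N)%N by move=> /asboolP/HN; lia.
case: (ex_minnP exP) => i Pi mini; case: (ex_maxnP exP ubP) => j Pj maxj.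
have ij : (i <= j)%N by exact: mini.
have leE (a b : int) : (a%:~R / n.+1%:R <= b%:~R / n.+1%:R :> R) = (a <= b).
  by rewrite ler_pM2r ?invr_gt0// ler_int.
have -> : fractions K n = (fun k : nat => i%:Z - N%:Z + k%:Z) @` `I_(j - i).+1.
  apply/seteqP; split=> [m' /PX[k Pk ->]|_ [k /= kji <-]].
    by have := mini _ Pk; have := maxj _ Pk => *; exists (k - i)%N => /=; lia.
  move/asboolP : Pi => Pi; move/asboolP : Pj => Pj.
  by apply: (iK _ _ Pi Pj); rewrite !leE; lia.
rewrite card_set_image; last 2 first.
- exact: finite_II.
- by move=> x y _ _ /=; lia.
rewrite /card_set fset_set_II card_imfset/=; last exact: val_inj.
rewrite -cardE card_ord.
have lo : ((j%:Z - N%:Z)%:~R / n.+1%:R - (i%:Z - N%:Z)%:~R / n.+1%:R : R) <= lam K.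
  apply: (lam_ge mK _ _ Kr); first by rewrite leE; lia.
  move/asboolP : Pi => Pi; move/asboolP : Pj => Pj u.
  by rewrite /= in_itv/=; exact: iK.
have up : lam K <= ((j%:Z - N%:Z + 1)%:~R / n.+1%:R - (i%:Z - N%:Z - 1)%:~R / n.+1%:R : R).
  apply: (lam_le mK); first by rewrite leE; lia.
  move/asboolP : Pi => Pi; move/asboolP : Pj => Pj u Ku.
  rewrite /= in_itv/= !leNgt; apply/andP; split; apply/negP => H.
    have /PX[k /mini + E] : fractions K n (i%:Z - N%:Z - 1).
      by apply: (iK _ _ Ku Pi); rewrite ltW//= leE; lia.
    by lia.
  have /PX[k /maxj + E] : fractions K n (j%:Z - N%:Z + 1).
    by apply: (iK _ _ Pj Ku); rewrite (ltW H) leE; lia.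
  by lia.
move: lo up; rewrite -!mulrBl ler_pdivrMr// ler_pdivlMr//.
rewrite -(natr1 (j - i)) natrB// !rmorphB/= !rmorphD/= !rmorphN/=.
rewrite -!pmulrn; set x := n.+1%:R => lo up; rewrite ler_norml; apply/andP; split; lra.
Qed.

End IntervalCount.

(** * Lattice points as a union of slices *)

Section LatticePoints.
Context {R : realType} (A B C : R).
Implicit Types (S : set R) (t r u : R) (n M d : nat) (p : int * int).

Local Notation q := (quad A B C).

Definition form p : R :=
  A * p.1%:~R ^+ 2 + B * p.1%:~R * p.2%:~R + C * p.2%:~R ^+ 2.

(** With the bound written as t^2, multiplying a point by d amounts to replacing t by t / d. *)
Definition lattice S t : set (int * int) :=
  [set p | [/\ (1 <= p.2)%R, S (p.1%:~R / p.2%:~R) & form p <= t ^+ 2]].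

Definition primitive S t : set (int * int) :=
  lattice S t `&` [set p | gcdz p.1 p.2 = 1].

(* The second alternative covers the arcs through oo, whose real part is the
   complement of an interval. *)
Definition arc S := coercive A B C S /\
  (is_interval S \/ 0 < A /\ is_interval (~` S)).

Definition sublevel S r : set R := S `&` [set u | q u <= r].

Lemma form_quad p : p.2 != 0 -> form p = p.2%:~R ^+ 2 * q (p.1%:~R / p.2%:~R).
Proof. by move=> p0; rewrite /form /quad; field; rewrite intr_eq0. Qed.

(** The count is the one for K minus the one for the intersection of K and K'; both are intervals,
    with an error of at most 1 each. *)
Lemma card_fractionsD K K' n r : is_interval K -> is_interval K' ->
  K `<=` `[- r, r] ->
  `|(card_set (fractions (K `\` K') n))%:R - n.+1%:R * lam (K `\` K')| <= 2.
Proof.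
move=> iK iK' Kr.
have iI : is_interval (K `&` K').
  by move=> x y [Kx K'x] [Ky K'y] z xyz; split; [apply: (iK x y)|apply: (iK' x y)].
have KIr : K `&` K' `<=` `[- r, r] by move=> x [/Kr].
have mK := is_interval_measurable iK; have mK' := is_interval_measurable iK'.
have E : lam K = lam (K `&` K') + lam (K `\` K').
  rewrite /lam addrC -fineD.
  - by congr fine; exact: measureDI.
  - by apply: lebesgue_measure_bounded (_ : _ `<=` `[- r, r]);
      [exact: measurableD|move=> x [/Kr]].
  - by apply: lebesgue_measure_bounded KIr; exact: measurableI.
have := card_setID (fractions K' n) (finite_fractions n Kr).
have := card_fractions n iK Kr; have := card_fractions n iI KIr.
rewrite E => + + /(congr1 (fun k : nat => k%:R : R)).
rewrite -[fractions K n `&` _]/(fractions (K `&` K') n).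
rewrite -[fractions K n `\` _]/(fractions (K `\` K') n) natrD !ler_norml.
set x := n.+1%:R => /andP[h1 h2] /andP[h3 h4] h5; apply/andP; split; lra.
Qed.

(** Convexity, through the identity (y - x)(r - q z) = (y - z)(r - q x) + (z - x)(r - q y) + A (y -
    x)(z - x)(y - z). *)
Lemma quad_le_interval r : 0 <= A -> is_interval [set u | q u <= r].
Proof.
move=> A0 x y /= qx qy z /andP[xz zy]; rewrite /quad in qx qy *.
have [xy|] := eqVneq x y; first by rewrite (_ : z = x)//; lra.
move=> xy; have {}xy : 0 < y - x by lra.
rewrite -(ler_pM2l xy).
have : 0 <= (y - z) * (r - (A * x ^+ 2 + B * x + C)) by rewrite mulr_ge0; lra.
have : 0 <= (z - x) * (r - (A * y ^+ 2 + B * y + C)) by rewrite mulr_ge0; lra.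
have : 0 <= A * ((y - x) * ((z - x) * (y - z))) by rewrite !mulr_ge0; lra.
nra.
Qed.

Lemma quad_gt_interval r : A <= 0 ->
  is_interval [set u | r < q u].
Proof.
move=> A0 x y /= qx qy z /andP[xz zy]; rewrite /quad in qx qy *.
have [xy|] := eqVneq x y; first by rewrite (_ : z = x)//; lra.
move=> xy; have {}xy : 0 < y - x by lra.
rewrite -(ltr_pM2l xy).
have H1 : 0 <= (y - z) * ((A * x ^+ 2 + B * x + C) - r) by rewrite mulr_ge0; lra.
have H2 : 0 <= (z - x) * ((A * y ^+ 2 + B * y + C) - r) by rewrite mulr_ge0; lra.
have H3 : 0 <= - A * ((y - x) * ((z - x) * (y - z))) by rewrite !mulr_ge0; lra.
have [xz'|xz'] := eqVneq z x; first by rewrite xz' ltr_pM2l.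
have H4 : 0 < (z - x) * ((A * y ^+ 2 + B * y + C) - r) by rewrite mulr_gt0; lra.
nra.
Qed.

Lemma sublevel_sub S r c : 0 < c -> (forall u, S u -> c * (1 + u ^+ 2) <= q u) ->
  sublevel S r `<=` `[- Num.sqrt (r / c), Num.sqrt (r / c)].
Proof.
move=> c0 Sc u [/Sc cu /= qur]; have ur : c * (1 + u ^+ 2) <= r by exact: le_trans qur.
rewrite /= in_itv/= -ler_norml -sqrtr_sqr ler_wsqrtr// ler_pdivlMr// mulrC.
by apply: le_trans ur; rewrite ler_pM2l// lerDr.
Qed.

Lemma arc_measurable S : arc S -> measurable S.
Proof.
case=> _ [/is_interval_measurable//|[_ /is_interval_measurable mS]].
by rewrite -(setCK S); exact: measurableC.
Qed.

(** The sublevel set is always a difference of two intervals, the first one bounded. For an arc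
    through oo, remove the complement of S from part of {q <= r}; for an interval S, the set is
    itself an interval if A >= 0, and otherwise {q > r} is removed from a bounded part of S. *)
Lemma card_sublevel S r n : arc S ->
  `|(card_set (fractions (sublevel S r) n))%:R - n.+1%:R * lam (sublevel S r)| <= 2.
Proof.
case=> -[c c0 Sc] Sshape; set a := Num.sqrt (r / c).
have bnd : sublevel S r `<=` `[- a, a] by exact: sublevel_sub.
have iI (X Y : set R) : is_interval X -> is_interval Y -> is_interval (X `&` Y).
  by move=> iX iY x y [Xx Yx] [Xy Yy] z xyz; split; [apply: (iX x y)|apply: (iY x y)].
have iseg : is_interval `[- a, a] by exact: interval_is_interval.
suff [K [K' [iK iK' Ka ->]]] : exists K K' : set R, [/\ is_interval K, is_interval K',
    K `<=` `[- a, a] & sublevel S r = K `\` K'] by exact: card_fractionsD Ka.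
case: Sshape => [iS|[A0 iS]]; last first.
  exists (`[- a, a] `&` [set u | q u <= r]), (~` S); split => //.
  - by apply: iI => //; apply: quad_le_interval; exact: ltW.
  - rewrite setDE setCK; apply/seteqP; split=> [x Sx|x [[_ ?] ?]]; last by split.
    by have := Sx => -[? ?]; do !split => //; exact: bnd.
have [A0|A0] := lerP 0 A.
  exists (sublevel S r), set0; split => //; last by rewrite setD0.
  by apply: iI => //; exact: quad_le_interval.
exists (S `&` `[- a, a]), [set u | r < q u]; split => //.
- exact: iI.
- by apply: quad_gt_interval; exact: ltW.
- apply/seteqP; split=> x.
    move=> Sx; have := Sx => -[Sx' /= qx].
    by split; [split => //; exact: bnd|rewrite /= ltNge qx].
  by move=> [[Sx _] /= /negP]; rewrite -leNgt.
Qed.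

(** A point of height n satisfies c n^2 <= n^2 q(m/n) <= t^2 < c (M+1)^2, so n <= M. Slice i has
    height i + 1. *)
Lemma lattice_slices S t c M : 0 < c ->
  (forall u, S u -> c * (1 + u ^+ 2) <= q u) -> t ^+ 2 < c * M.+1%:R ^+ 2 ->
  lattice S t = \bigcup_(i < M)
    ((fun m : int => (m, i.+1%:Z)) @` fractions (sublevel S ((t / i.+1%:R) ^+ 2)) i).
Proof.
move=> c0 Sc tM; apply/seteqP; split=> [|_ [i /= iM [m [Sm /= qm] <-]]].
  move=> [m [[|i]|i]] [//= _ Sn Qn].
  rewrite form_quad//= -[i.+1%:~R]/(i.+1%:R) in Sn Qn.
  have iR0 : (0 : R) < i.+1%:R by rewrite ltr0n.
  exists i => /=; last first.
    exists m => //; split => //=.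
    by rewrite expr_div_n ler_pdivlMr ?exprn_gt0// mulrC.
  rewrite ltnNge; apply/negP => Mi; move: tM; rewrite ltNge => /negP; apply.
  have cq : c <= q (m%:~R / i.+1%:R).
    by apply: le_trans (Sc _ Sn); rewrite ler_pMr// lerDl sqr_ge0.
  apply: le_trans Qn; rewrite mulrC; apply: ler_pM cq; rewrite ?exprn_ge0 ?(ltW c0)//.
  by rewrite lerXn2r ?nnegrE ?ler0n// ler_nat.
split => //=.
rewrite form_quad//= -pmulrn mulrC -ler_pdivlMr ?exprn_gt0 ?ltr0n//.
by rewrite -expr_div_n.
Qed.

Lemma finite_sublevel S r n : arc S -> finite_set (fractions (sublevel S r) n).
Proof.
by case=> -[c c0 Sc] _; apply: finite_fractions; exact: sublevel_sub Sc.
Qed.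

Lemma card_lattice S t c M : arc S -> 0 < c ->
  (forall u, S u -> c * (1 + u ^+ 2) <= q u) -> t ^+ 2 < c * M.+1%:R ^+ 2 ->
  finite_set (lattice S t) /\
  card_set (lattice S t) =
    (\sum_(0 <= i < M) card_set (fractions (sublevel S ((t / i.+1%:R) ^+ 2)) i))%N.
Proof.
move=> aS c0 Sc tM; rewrite (lattice_slices c0 Sc tM); split.
  by apply: bigcup_finite => // i _; apply: finite_image; exact: finite_sublevel.
rewrite card_set_bigcup.
- apply: eq_bigr => i _; rewrite card_set_image//; first exact: finite_sublevel.
  by move=> x y _ _ [].
- by move=> i; apply: finite_image; exact: finite_sublevel.
- apply/trivIsetP => i j _ _ ij; rewrite -subset0.
  by move=> _ [[m _ <-] [m' _ [_ ji]]]; case/eqP: ij; lia.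
Qed.

End LatticePoints.

(** * Asymptotics of the lattice point count *)

Section Density.
Context {R : realType} (A B C : R).
Implicit Types (S : set R) (c t r u x : R) (n M d : nat).

Local Notation q := (quad A B C).

(* The slice of [lattice A B C S t] at height n = i + 1 has about
   n * lam (sublevel A B C S ((t / n) ^+ 2)) points; [dens] comes from writing
   these lengths as integrals over S and exchanging sum and integral. *)
Definition dens c S t u : R :=
  \sum_(0 <= i < Num.trunc (t / Num.sqrt c))
    (i.+1%:R / t ^+ 2) * \1_(sublevel A B C S ((t / i.+1%:R) ^+ 2)) u.

Lemma sum_succn n : \sum_(0 <= i < n) (i.+1%:R : R) = n%:R * (n%:R + 1) / 2.
Proof.
elim: n => [|n IH]; first by rewrite big_geq// !mul0r.
by rewrite big_nat_recr//= IH -natr1; field.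
Qed.

(** On S the condition q u <= (t/(i+1))^2 says i + 1 <= t / sqrt (q u), that is i < N, so the sum is
    1 + ... + N over t^2. The range of summation reaches N because c <= q u. *)
Lemma dens_truncE c S t u : 0 < t -> 0 < c -> S u -> c <= q u ->
  let N := Num.trunc (t / Num.sqrt (q u)) in
  dens c S t u = N%:R * (N%:R + 1) / 2 / t ^+ 2.
Proof.
move=> t0 c0 Su cq N; have q0 : 0 < q u by exact: lt_le_trans cq.
have s0 : 0 < Num.sqrt (q u) by rewrite sqrtr_gt0.
rewrite -sum_succn mulr_suml /dens.
have NM : (N <= Num.trunc (t / Num.sqrt c))%N.
  apply: le_truncn; rewrite ler_pM2l// lef_pV2 ?posrE ?sqrtr_gt0//.
  exact: ler_wsqrtr.
rewrite [RHS](big_nat_widen _ _ _ _ _ NM) [RHS]big_mkcond/=.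
apply: eq_big_nat => i _; rewrite indicE.
have ti : 0 < t / i.+1%:R by rewrite divr_gt0 ?ltr0n.
have iN : (i < N)%N = (q u <= (t / i.+1%:R) ^+ 2).
  rewrite truncn_ge_nat ?divr_ge0 ?(ltW t0)// ler_pdivlMr// mulrC -ler_pdivlMr ?ltr0n//.
  by rewrite -[in RHS](sqr_sqrtr (ltW q0)) ler_pXn2r ?nnegrE ?(ltW s0) ?(ltW ti).
suff -> : (u \in sublevel A B C S ((t / i.+1%:R) ^+ 2)) = (i < N)%N.
  by case: ifP; rewrite ?mulr1 ?mulr0.
by rewrite iN; apply/idP/idP => [/set_mem[]//|H]; apply/mem_set.
Qed.

(** N(N+1)/2 <= N^2 <= t^2 / q u. Dominated convergence uses this bound at every term of a sequence,
    including any t <= 0, where the sum is empty. *)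
Lemma dens_bounds c S t u : 0 < c -> S u -> c <= q u ->
  0 <= dens c S t u <= (q u)^-1.
Proof.
move=> c0 Su cq; have q0 : 0 < q u by exact: lt_le_trans cq.
have [t0|t0] := ltP 0 t; last first.
  rewrite /dens (_ : Num.trunc _ = 0%N) ?big_geq ?lexx ?invr_ge0 ?ltW//.
  by apply/truncn0Pn; rewrite -ltNge (le_lt_trans _ ltr01)// pmulr_lle0// invr_gt0 sqrtr_gt0.
rewrite dens_truncE//; set N := Num.trunc _.
have t20 : 0 < t ^+ 2 by rewrite exprn_gt0.
have x0 : 0 <= t / Num.sqrt (q u) by rewrite divr_ge0 ?sqrtr_ge0// ltW.
have Nx : N%:R <= t / Num.sqrt (q u) by case/andP: (truncn_itv x0).
apply/andP; split; first by rewrite !divr_ge0 ?mulr_ge0 ?addr_ge0// ltW.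
rewrite ler_pdivrMr// [leRHS]mulrC.
have -> : t ^+ 2 / q u = (t / Num.sqrt (q u)) ^+ 2 by rewrite expr_div_n sqr_sqrtr// ltW.
apply: (@le_trans _ _ (N%:R ^+ 2)); last by rewrite lerXn2r// nnegrE.
have : (N%:R : R) <= N%:R ^+ 2 by rewrite -natrX ler_nat; case: (N) => // k; rewrite leq_pmulr.
by rewrite ler_pdivrMr// expr2; lra.
Qed.

(** With x = t / sqrt (q u) and N <= x < N + 1, one has |x^2 - N(N+1)| <= x. *)
Lemma dens_dist c S t u : 0 < t -> 0 < c -> S u -> c <= q u ->
  `|(2 * q u)^-1 - dens c S t u| <= (2 * Num.sqrt (q u))^-1 / t.
Proof.
move=> t0 c0 Su cq; have q0 : 0 < q u by exact: lt_le_trans cq.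
have s0 : 0 < Num.sqrt (q u) by rewrite sqrtr_gt0.
rewrite dens_truncE//; set N := Num.trunc _.
have x0 : 0 <= t / Num.sqrt (q u) by rewrite divr_ge0 ?sqrtr_ge0// ltW.
have /andP[] := truncn_itv x0; rewrite -/N -natr1.
set x := t / _ in x0 * => Nx xN.
have -> : (2 * q u)^-1 = x ^+ 2 / 2 / t ^+ 2.
  rewrite /x expr_div_n sqr_sqrtr ?ltW//; field.
  by rewrite (gt_eqF q0) (gt_eqF t0).
have -> : (2 * Num.sqrt (q u))^-1 / t = x / 2 / t ^+ 2.
  by rewrite /x; field; rewrite (gt_eqF s0) (gt_eqF t0).
rewrite -mulrBl normrM [X in _ * X]ger0_norm ?invr_ge0 ?exprn_ge0 ?(ltW t0)//.
rewrite ler_wpM2r ?invr_ge0 ?exprn_ge0 ?(ltW t0)// ler_norml.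
have N0 : 0 <= N%:R :> R by [].
by apply/andP; split; nra.
Qed.

Lemma sublevel_measurable S r : measurable S -> measurable (sublevel A B C S r).
Proof.
move=> mS; apply: measurableI => //.
have -> : [set u | q u <= r] = q @^-1` `]-oo, r]%classic.
  by apply/seteqP; split => u /=; rewrite in_itv.
rewrite -[_ @^-1` _]setTI; apply: (continuous_measurable_fun (@quad_continuous R A B C)) => //.
Qed.

Lemma dens_measurable c S t : measurable S -> measurable_fun S (dens c S t).
Proof.
move=> mS; apply: measurable_sum => i; apply: measurable_funM; first exact: measurable_cst.
by apply: measurable_indic; exact: sublevel_measurable.
Qed.

Lemma integral_dens c S t : arc A B C S ->
  (\int[@lebesgue_measure R]_(u in S) (dens c S t u)%:E =
  ((\sum_(0 <= i < Num.trunc (t / Num.sqrt c))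
     i.+1%:R * lam (sublevel A B C S ((t / i.+1%:R) ^+ 2))) / t ^+ 2)%:E)%E.
Proof.
move=> aS; have mS := arc_measurable aS.
rewrite /dens; under eq_integral do rewrite -sumEFin.
rewrite ge0_integral_sum//; last 2 first.
- move=> i; apply/measurable_EFinP; apply: measurable_funM; first exact: measurable_cst.
  by apply: measurable_indic; exact: sublevel_measurable.
- by move=> i u _; rewrite lee_fin mulr_ge0// divr_ge0// sqr_ge0.
rewrite mulr_suml -sumEFin; apply: eq_bigr => i _.
have mE := sublevel_measurable ((t / i.+1%:R) ^+ 2) mS.
under eq_integral do rewrite EFinM.
rewrite ge0_integralZl_EFin//; last 2 first.
- by apply/measurable_EFinP; exact: measurable_indic.
- by rewrite divr_ge0// sqr_ge0.
rewrite integral_indic// (_ : _ `&` S = sublevel A B C S ((t / i.+1%:R) ^+ 2)); last first.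
  by apply/setIidPl => x [].
have fE : @lebesgue_measure R (sublevel A B C S ((t / i.+1%:R) ^+ 2)) \is a fin_num.
  by case: aS => -[c' c'0 Sc'] _; apply: lebesgue_measure_bounded (sublevel_sub c'0 Sc').
by rewrite mulrAC [RHS]EFinM; congr (_ * _)%E; exact: esym (fineK fE).
Qed.

Lemma integrable_oneDsqrV :
  (@lebesgue_measure R).-integrable setT (fun u => ((1 + u ^+ 2)^-1)%:E).
Proof.
have mf : measurable_fun setT (fun u : R => (1 + u ^+ 2)^-1).
  exact: (continuous_measurable_fun (@continuous_oneDsqrV R)).
have f0 u : 0 <= (1 + u ^+ 2 : R)^-1 by rewrite invr_ge0 ltW// oneDsqr_pos.
apply/integrableP; split; first exact/measurable_EFinP.
under eq_integral do rewrite gee0_abs ?lee_fin//.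
rewrite (@ge0_symfun_integralT R (fun u => (1 + u ^+ 2)^-1))//.
- by rewrite -set_itvcy integral0y_oneDsqr -EFinM ltry.
- exact: continuous_oneDsqrV.
- by move=> x /=; rewrite sqrrN.
Qed.

(** Coercivity gives the integrable majorant 1/(c (1 + u^2)), so the mass is finite also on arcs
    through oo. *)
Lemma integrable_quadV S : arc A B C S ->
  (@lebesgue_measure R).-integrable S (fun u => ((q u)^-1)%:E).
Proof.
move=> aS; have mS := arc_measurable aS; case: aS => -[c c0 Sc] _.
have qopen : open [set u | 0 < q u].
  have -> : [set u | 0 < q u] = q @^-1` [set x | 0 < x] by [].
  by apply: open_comp => [u _|]; [exact: quad_continuous|exact: open_gt].
have H : (@lebesgue_measure R).-integrable S (fun u => c^-1%:E * ((1 + u ^+ 2)^-1)%:E)%E.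
  apply: integrableZl => //.
  apply: (@integrableS _ _ _ _ setT) => //; exact: integrable_oneDsqrV.
apply: le_integrable H => //.
  apply/measurable_EFinP.
  apply: (@measurable_funS _ _ _ _ [set u | 0 < q u]).
  - exact: open_measurable qopen.
  - by move=> u /Sc; apply: lt_le_trans; rewrite mulr_gt0 ?oneDsqr_pos.
  - apply: open_continuous_measurable_fun => // u /set_mem/= qu.
    apply: cvgV; first by rewrite gt_eqF.
    exact: quad_continuous.
move=> u Su; have cu := Sc _ Su.
have pos : 0 < c * (1 + u ^+ 2) by rewrite mulr_gt0 ?oneDsqr_pos.
rewrite -EFinM !abse_EFin lee_fin -invfM !normfV.
rewrite !ger0_norm ?lef_pV2 ?posrE//; lra.
Qed.

End Density.

(** * Order and density of the lattice count, and its decomposition by gcd *)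

Section Counting.
Context {R : realType} (A B C : R).
Implicit Types (S : set R) (c t r u x : R) (n M d : nat).

Local Notation q := (quad A B C).

Definition mass S : R := fine (\int[@lebesgue_measure R]_(u in S) ((q u)^-1)%:E)%E.

Lemma trunc_sqr c t : 0 < c -> 0 < t ->
  t ^+ 2 < c * (Num.trunc (t / Num.sqrt c)).+1%:R ^+ 2 /\
  (Num.trunc (t / Num.sqrt c))%:R <= t / Num.sqrt c.
Proof.
move=> c0 t0; have s0 : 0 < Num.sqrt c by rewrite sqrtr_gt0.
have x0 : 0 < t / Num.sqrt c by rewrite divr_gt0.
have /andP[Mx xM] := truncn_itv (ltW x0); split => //.
rewrite -[ltRHS]mulrC -ltr_pdivrMr// -[in ltLHS](sqr_sqrtr (ltW c0)) -expr_div_n.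
by rewrite ltr_pXn2r// nnegrE ltW.
Qed.

(** With x = t / sqrt c there are M <= x slices of at most 2 + 2x points each. Unless M = 0, this
    forces x >= 1 and M(2 + 2x) <= 4 x^2, whence the constant 4/c, valid for every t > 0. *)
Lemma lattice_quadratic_bound S : arc A B C S ->
  exists2 K, 0 <= K & forall t, 0 < t -> (card_set (lattice A B C S t))%:R <= K * t ^+ 2.
Proof.
move=> aS; have := aS => -[[c c0 Sc] _]; exists (4 / c); first by rewrite divr_ge0 ?ltW.
move=> t t0; have [tM Mt] := trunc_sqr c0 t0.
have [_ ->] := card_lattice aS c0 Sc tM; set M := Num.trunc _ in tM Mt *.
have s0 : 0 < Num.sqrt c by rewrite sqrtr_gt0.
set x := t / Num.sqrt c in Mt *; have x0 : 0 < x by rewrite divr_gt0.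
have slice i : (card_set (fractions (sublevel A B C S ((t / i.+1%:R) ^+ 2)) i))%:R <= 2 + 2 * x.
  have := card_sublevel ((t / i.+1%:R) ^+ 2) i aS; rewrite ler_norml => /andP[_].
  rewrite lerBlDr => /le_trans; apply; rewrite lerD2l.
  have lamx : lam (sublevel A B C S ((t / i.+1%:R) ^+ 2)) <= x / i.+1%:R + x / i.+1%:R.
    have -> : x / i.+1%:R = Num.sqrt ((t / i.+1%:R) ^+ 2 / c).
      by rewrite sqrtrM ?sqr_ge0// sqrtr_sqr sqrtrV ?ltW// ger0_norm ?divr_ge0 ?(ltW t0)// mulrAC.
    rewrite -[X in _ + X]opprK; apply: lam_le; last exact: sublevel_sub Sc.
    - apply: sublevel_measurable; exact: arc_measurable aS.
    - by rewrite (@le_trans _ _ 0)// ?oppr_le0 sqrtr_ge0.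
  apply: le_trans (ler_wpM2l (ler0n _ _) lamx) _.
  by rewrite -mulrDl mulrCA divff ?pnatr_eq0// mulr1; lra.
rewrite natr_sum; apply: (@le_trans _ _ (\sum_(0 <= i < M) (2 + 2 * x))).
  by apply: ler_sum => i _; exact: slice.
rewrite sumr_const_nat subn0 -[leLHS]mulr_natr.
have -> : 4 / c * t ^+ 2 = 4 * x ^+ 2 by rewrite expr_div_n sqr_sqrtr ?ltW//; ring.
have [->|] := posnP M; first by rewrite mulr0 mulr_ge0// sqr_ge0.
by rewrite -(ler_nat R) => M1; nra.
Qed.

Lemma lattice_density S : arc A B C S ->
  (card_set (lattice A B C S t))%:R / t ^+ 2 @[t --> +oo] --> mass S / 2.
Proof.
move=> aS; apply/cvg_pinftyP => tk tkoo.
have mS := arc_measurable aS; have := aS => -[[c c0 Sc] _].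
have cq u : S u -> c <= q u.
  by move=> /Sc; apply: le_trans; rewrite ler_pMr// lerDl sqr_ge0.
have q0 u : S u -> 0 < q u by move=> /cq; exact: lt_le_trans.
have s0 : 0 < Num.sqrt c by rewrite sqrtr_gt0.
(* [D] is the normalized count with each slice replaced by its expected size; by [integral_dens] it
   is the integral of [dens]. *)
pose D n : R := (\sum_(0 <= i < Num.trunc (tk n / Num.sqrt c))
     i.+1%:R * lam (sublevel A B C S ((tk n / i.+1%:R) ^+ 2))) / tk n ^+ 2.
have iq := integrable_quadV aS.
have i2 := @integrableZl _ _ _ (@lebesgue_measure R) S mS 2^-1 _ iq.
have Dcvg : D n @[n --> \oo] --> mass S / 2.
  have [|||_ _] := @dominated_convergence _ _ _ (@lebesgue_measure R) S mS
    (fun n u => (dens A B C c S (tk n) u)%:E) _ (fun u => ((q u)^-1)%:E) _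
    (measurable_int _ i2) _ iq.
  - by move=> n; apply/measurable_EFinP; exact: dens_measurable.
  - apply: aeW => u Su; rewrite -EFinM -invfM; apply: cvg_EFin; first exact: nearW.
    apply/cvgrPdist_le => e e0.
    have su : 0 < (2 * Num.sqrt (q u))^-1 by rewrite invr_gt0 mulr_gt0// sqrtr_gt0 q0.
    have : \forall n \near \oo, Num.max 1 ((2 * Num.sqrt (q u))^-1 / e) <= tk n.
      by move: tkoo => /cvgryPge; exact.
    apply: filterS => n; rewrite ge_max => /andP[t1 te].
    have t0 : 0 < tk n by rewrite (lt_le_trans _ t1).
    apply: le_trans (dens_dist t0 c0 Su (cq _ Su)) _.
    by rewrite ler_pdivrMr// [leRHS]mulrC -ler_pdivrMr.
  - apply: aeW => u n Su; have /andP[d0 dq] := dens_bounds (tk n) c0 Su (cq _ Su).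
    by rewrite abse_EFin lee_fin ger0_norm.
  have fin := @integrable_fin_num _ _ _ (@lebesgue_measure R) S mS _ iq.
  rewrite integralZl// -(fineK fin) -EFinM => /fine_cvg.
  rewrite mulrC; apply: cvg_trans; apply: near_eq_cvg; apply: nearW => n /=.
  by rewrite /D integral_dens.
apply/cvgrPdist_le => e e0.
have e2 : 0 < e / 2 by rewrite divr_gt0.
(* At most t / sqrt c slices, each off by at most 2, give an error of at most (2 / sqrt c) / t after
   division by t^2. *)
have tkbig : \forall n \near \oo, Num.max 1 (2 / Num.sqrt c / (e / 2)) <= tk n.
  by move: tkoo => /cvgryPge; exact.
move/cvgrPdist_le : Dcvg => /(_ _ e2) Dnear; near=> n.
have : Num.max 1 (2 / Num.sqrt c / (e / 2)) <= tk n by near: n.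
have Dn : `|mass S / 2 - D n| <= e / 2 by near: n.
rewrite ge_max => /andP[t1 te]; have t0 : 0 < tk n by rewrite (lt_le_trans _ t1).
have [tM Mt] := trunc_sqr c0 t0.
have [_ ->] := card_lattice aS c0 Sc tM.
rewrite (_ : _ - _ = mass S / 2 - D n + (D n -
  (\sum_(0 <= i < Num.trunc (tk n / Num.sqrt c))
    card_set (fractions (sublevel A B C S ((tk n / i.+1%:R) ^+ 2)) i))%:R / tk n ^+ 2));
  last by rewrite addrA subrK.
rewrite (le_trans (ler_normD _ _))// [leRHS]splitr lerD//.
rewrite /D -mulrBl normrM [X in _ * X]ger0_norm ?invr_ge0 ?sqr_ge0//.
rewrite ler_pdivrMr ?exprn_gt0// natr_sum -sumrB.
apply: (@le_trans _ _ (\sum_(0 <= i < Num.trunc (tk n / Num.sqrt c)) 2)).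
  apply: le_trans (ler_norm_sum _ _ _) _; apply: ler_sum => i _.
  by rewrite distrC card_sublevel.
rewrite sumr_const_nat subn0 -[leLHS]mulr_natr.
apply: le_trans (ler_wpM2l _ Mt) _ => //.
rewrite mulrCA [leLHS]mulrC expr2 mulrA ler_wpM2r ?(ltW t0)//.
by rewrite [leRHS]mulrC -ler_pdivrMr.
Unshelve. all: by end_near. Qed.

(* Sorting the lattice points by their gcd d + 1. *)
Lemma lattice_primitives S t c M : arc A B C S -> 0 < c ->
  (forall u, S u -> c * (1 + u ^+ 2) <= q u) -> t ^+ 2 < c * M.+1%:R ^+ 2 ->
  card_set (lattice A B C S t) =
  (\sum_(0 <= d < M) card_set (primitive A B C S (t / d.+1%:R)))%N.
Proof.
move=> aS c0 Sc tM.
pose scale d (p : int * int) := (d.+1%:Z * p.1, d.+1%:Z * p.2).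
have scale_inj d : injective (scale d) by move=> [m n] [m' n'] [? ?]; congr pair; nia.
have gcd_scale d p : gcdz p.1 p.2 = 1 -> gcdz (scale d p).1 (scale d p).2 = d.+1%:Z.
  by move=> p1; rewrite -mulz_gcdr p1 mulr1.
have fin d : finite_set (primitive A B C S (t / d.+1%:R)).
  apply: finite_setIl; apply: (card_lattice (M := M) aS c0 Sc _).1.
  apply: le_lt_trans tM; rewrite expr_div_n ler_pdivrMr ?exprn_gt0//.
  by rewrite ler_peMr ?sqr_ge0// exprn_ege1// ler1n.
have latticeZ d p : lattice A B C S t (scale d p) <-> lattice A B C S (t / d.+1%:R) p.
  have d0 : (d.+1%:Z)%:~R != 0 :> R by rewrite -pmulrn pnatr_eq0.
  have formZ : form A B C (scale d p) = d.+1%:R ^+ 2 * form A B C p.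
    by rewrite /form /= !rmorphM/= -!pmulrn; ring.
  rewrite /lattice /= formZ !rmorphM/= -mulf_div divff// mul1r.
  rewrite expr_div_n ler_pdivlMr ?exprn_gt0// [_ ^+ 2 * form _ _ _ _]mulrC.
  by split=> -[p1 Sp fp]; split => //; move: p1; rewrite -!gtz0_ge1 pmulr_rgt0.
have -> : lattice A B C S t = \bigcup_(d < M) (scale d @` primitive A B C S (t / d.+1%:R)).
  apply/seteqP; split=> [[m n] Lmn|_ [d _ [p [Lp _] <-]]]; last exact/latticeZ.
  have [/= n1 _ _] := Lmn; have nM : n <= M%:Z.
    by move: Lmn; rewrite (lattice_slices c0 Sc tM) => -[i /= iM [_ _ [_ <-]]].
  have g0 : gcdz m n != 0 by rewrite gcdz_eq0 negb_and; apply/orP; right; lia.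
  have := divzK (dvdz_gcdl m n); have := divzK (dvdz_gcdr m n).
  set m' := (m %/ _)%Z; set n' := (n %/ _)%Z => nE mE.
  pose d := (gcdn (absz m) (absz n)).-1.
  have gE : gcdz m n = d.+1%:Z.
    by rewrite /d prednK// gcdn_gt0; apply/orP; right; lia.
  have scaleE : (m, n) = scale d (m', n').
    by rewrite /scale/= -gE ![gcdz m n * _]mulrC mE nE.
  have gn : (gcdn (absz m) (absz n) <= absz n)%N by apply: dvdn_leq (dvdn_gcdr _ _); lia.
  exists d => /=; first by move: gE gn; rewrite /gcdz => -[->]; lia.
  exists (m', n') => //; split; first by apply/latticeZ; rewrite -scaleE.
  have E : d.+1%:Z * gcdz m' n' = gcdz m n.
    transitivity (gcdz (d.+1%:Z * m') (d.+1%:Z * n')); first exact: (mulz_gcdr d.+1%:Z m' n').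
    by rewrite -gE ![gcdz m n * _]mulrC mE nE.
  by apply: (@mulfI _ d.+1%:Z) => //; rewrite E gE mulr1.
rewrite card_set_bigcup.
- by apply: eq_bigr => d _; rewrite card_set_image// => x y _ _; exact: scale_inj.
- by move=> d; apply: finite_image.
- apply/trivIsetP => i j _ _ ij; rewrite -subset0 => _ [[p [_ pp] <-] [p' [_ pp'] E]].
  have := gcd_scale i p pp; rewrite -E gcd_scale// => -[ji].
  by rewrite ji eqxx in ij.
Qed.

End Counting.

(** * Coprime pairs *)

Section Ratio.
Context {R : realType} (A B C : R).
Implicit Types (S : set R) (c t r u x e : R) (n M d : nat).

Local Notation q := (quad A B C).

Lemma near_pinftyW (P : R -> Prop) : (\forall t \near +oo, P t) ->
  exists T, forall t, T <= t -> P t.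
Proof.
move=> [T [_ PT]]; exists (T + 1) => t Tt; apply: PT.
by apply: lt_le_trans Tt; rewrite ltrDl.
Qed.

Lemma lattice_near S e : arc A B C S -> 0 < e -> exists T, forall t, T <= t ->
  `|(card_set (lattice A B C S t))%:R - mass A B C S / 2 * t ^+ 2| <= e * t ^+ 2.
Proof.
move=> aS e0; have /cvgrPdist_le/(_ e e0) := lattice_density aS.
move=> /near_pinftyW[T HT]; exists (Num.max T 1) => t; rewrite ge_max => /andP[/HT{}HT t1].
have t0 : 0 < t by rewrite (lt_le_trans _ t1).
have t20 : 0 < t ^+ 2 by rewrite exprn_gt0.
rewrite distrC -[X in `|_ - X|](divfK (lt0r_neq0 t20)) -mulrBl normrM (gtr0_norm t20).
by rewrite ler_pM2r.
Qed.

Lemma finite_lattice S t : arc A B C S -> 0 < t -> finite_set (lattice A B C S t).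
Proof.
move=> aS t0; have := aS => -[[c c0 Sc] _].
exact: (card_lattice aS c0 Sc (trunc_sqr c0 t0).1).1.
Qed.

Lemma card_primitive_le S t : arc A B C S -> 0 < t ->
  (card_set (primitive A B C S t) <= card_set (lattice A B C S t))%N.
Proof. by move=> aS t0; apply: le_card_set => [|p []//]; exact: finite_lattice. Qed.

(** Primitive counts are at most lattice counts, about a t^2, so the terms d >= 1 sum to at most
    about 3/4 a t^2 and the term d = 0 keeps about a/4 t^2. *)
Lemma primitive_lower_bound S : arc A B C S -> 0 < mass A B C S ->
  exists2 delta, 0 < delta & exists T, forall t, T <= t ->
    delta * t ^+ 2 <= (card_set (primitive A B C S t))%:R.
Proof.
move=> aS m0; set a := mass A B C S / 2; have a0 : 0 < a by rewrite divr_gt0.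
(* The errors leave a (1 - 1/16 - 3/4 * 17/16 - 1/16) = 5/64 a, which exceeds a/16. *)
exists (a / 16); first by rewrite divr_gt0.
have e0 : 0 < a / 16 by rewrite divr_gt0.
have [K K0 LK] := lattice_quadratic_bound aS.
have [T1 HT1] := lattice_near aS e0.
have P0 t : `|(card_set (primitive A B C S t))%:R : R| = (card_set (primitive A B C S t))%:R.
  by rewrite normr_nat.
have [|||T2 HT2] := @sum_dilates_le R (fun t => (card_set (primitive A B C S t))%:R)
    K (a + a / 16) (a / 16) (Num.max T1 1) K0 _ e0.
- by rewrite addr_ge0// ltW.
- by move=> t t0; rewrite P0 (le_trans _ (LK _ t0))// ler_nat card_primitive_le.
- move=> t; rewrite ge_max => /andP[/HT1{}HT1 t1]; rewrite P0.
  have t0 : 0 < t by rewrite (lt_le_trans _ t1).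
  apply: (@le_trans _ _ (card_set (lattice A B C S t))%:R).
    by rewrite ler_nat card_primitive_le.
  by move: HT1; rewrite ler_norml -/a => /andP[_]; lra.
exists (Num.max (Num.max T1 T2) 1) => t; rewrite !ge_max => /andP[/andP[/HT1{}HT1 /HT2{}HT2] t1].
have t0 : 0 < t by rewrite (lt_le_trans _ t1).
have := aS => -[[c c0 Sc] _]; have [tM _] := trunc_sqr c0 t0.
set M := Num.trunc _ in tM.
(* Since M may be 0, M + 1 is used as the bound, so that the term d = 0 is always present. *)
have tM1 : t ^+ 2 < c * M.+2%:R ^+ 2.
  by apply: lt_le_trans tM _; rewrite ler_pM2l// lerXn2r ?nnegrE ?ler0n// ler_nat.
have LP := lattice_primitives aS c0 Sc tM1.
have {}HT2 : \sum_(1 <= d < M.+1) (card_set (primitive A B C S (t / d.+1%:R)))%:R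
    <= (3 / 4 * (a + a / 16) + a / 16) * t ^+ 2.
  by apply: le_trans (HT2 M.+1); apply: ler_sum => d _; rewrite P0.
move: HT1 HT2; rewrite LP -/a natr_sum big_ltn// divr1 ler_norml => /andP[+ _].
set X := (card_set _)%:R; set Y := \sum_(_ <= _ < _) _; set z := t ^+ 2.
have z0 : 0 < z by rewrite exprn_gt0.
have az : 0 < a * z by rewrite mulr_gt0.
move=> h1 h2; lra.
Qed.

Lemma primitive_ratio S1 S2 : arc A B C S1 -> arc A B C S2 -> S1 `<=` S2 ->
  0 < mass A B C S2 -> forall e, 0 < e -> exists T, forall t, T <= t ->
  `|mass A B C S1 / mass A B C S2 -
    (card_set (primitive A B C S1 t))%:R / (card_set (primitive A B C S2 t))%:R| <= e.
Proof.
move=> aS1 aS2 S12 m0 e e0.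
set m1 := mass A B C S1; set m2 := mass A B C S2 in m0 *.
have [delta delta0 [T1 HT1]] := primitive_lower_bound aS2 m0.
pose P1 t : R := (card_set (primitive A B C S1 t))%:R.
pose P2 t : R := (card_set (primitive A B C S2 t))%:R.
pose f t := m2 * P1 t - m1 * P2 t.
have [K1 K10 LK1] := lattice_quadratic_bound aS1.
have [K2 K20 LK2] := lattice_quadratic_bound aS2.
have fK t : 0 < t -> `|f t| <= (`|m2| * K1 + `|m1| * K2) * t ^+ 2.
  move=> t0; apply: le_trans (ler_normB _ _) _; rewrite !normrM !normr_nat mulrDl -!mulrA.
  apply: lerD; rewrite ler_wpM2l//.
    by apply: le_trans (LK1 _ t0); rewrite ler_nat card_primitive_le.
  by apply: le_trans (LK2 _ t0); rewrite ler_nat card_primitive_le.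
have fsum e' : 0 < e' -> exists T, forall t, T <= t ->
    exists2 M, (0 < M)%N & `|\sum_(0 <= d < M) f (t / d.+1%:R)| <= e' * t ^+ 2.
  move=> e'0; pose D := `|m1| + `|m2| + 1.
  have D0 : 0 < D by rewrite ltr_wpDl ?addr_ge0.
  have [T2 HT2] := lattice_near aS1 (divr_gt0 e'0 D0).
  have [T3 HT3] := lattice_near aS2 (divr_gt0 e'0 D0).
  exists (Num.max (Num.max T2 T3) 1) => t.
  rewrite !ge_max => /andP[/andP[/HT2{}HT2 /HT3{}HT3] t1].
  have t0 : 0 < t by rewrite (lt_le_trans _ t1).
  have := aS2 => -[[c c0 Sc2] _]; have [tM _] := trunc_sqr c0 t0.
  set M := Num.trunc _ in tM; exists M.+1 => //.
  have tM1 : t ^+ 2 < c * M.+2%:R ^+ 2.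
    by apply: lt_le_trans tM _; rewrite ler_pM2l// lerXn2r ?nnegrE ?ler0n// ler_nat.
  (* The constant of S2 also serves S1, so both gcd decompositions have the same length and combine
     termwise into a sum of f. *)
  have Sc1 u : S1 u -> c * (1 + u ^+ 2) <= q u by move=> /S12; exact: Sc2.
  have LP1 := lattice_primitives aS1 c0 Sc1 tM1.
  have LP2 := lattice_primitives aS2 c0 Sc2 tM1.
  rewrite /f sumrB -!mulr_sumr /P1 /P2 -!natr_sum -LP1 -LP2.
  set L1 := (card_set _)%:R in HT2 *; set L2 := (card_set _)%:R in HT3 *.
  have -> : m2 * L1 - m1 * L2 = m2 * (L1 - m1 / 2 * t ^+ 2) - m1 * (L2 - m2 / 2 * t ^+ 2).
    by field.
  apply: le_trans (ler_normB _ _) _; rewrite !normrM.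
  apply: le_trans (lerD (ler_wpM2l (normr_ge0 _) HT2) (ler_wpM2l (normr_ge0 _) HT3)) _.
  rewrite -mulrDl mulrA ler_wpM2r ?sqr_ge0// mulrCA ler_piMr ?(ltW e'0)//.
  by rewrite ler_pdivrMr// mul1r /D; lra.
have K0 : 0 <= `|m2| * K1 + `|m1| * K2 by rewrite addr_ge0 ?mulr_ge0.
(* The difference of ratios is - f t / (m2 * P2 t), and P2 t >= delta t^2. *)
have e1 : 0 < e * (m2 * delta) by rewrite !mulr_gt0.
have [T2 HT2] := small_of_sum_dilates K0 fK fsum e1.
exists (Num.max (Num.max T1 T2) 1) => t.
rewrite !ge_max => /andP[/andP[/HT1{}HT1 /HT2{}HT2] t1].
have t20 : 0 < t ^+ 2 by rewrite exprn_gt0// (lt_le_trans _ t1).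
have P20 : 0 < P2 t by apply: lt_le_trans HT1; rewrite mulr_gt0.
rewrite -/(P1 t) -/(P2 t).
have -> : m1 / m2 - P1 t / P2 t = - f t / (m2 * P2 t).
  by rewrite /f; field; rewrite !gt_eqF.
rewrite normrM normrN normfV [X in _ / X]gtr0_norm ?mulr_gt0// ler_pdivrMr ?mulr_gt0//.
apply: le_trans HT2 _; rewrite -!mulrA ler_pM2l// ler_pM2l//.
Qed.

End Ratio.

(** * From coprime pairs to reduced fractions on the circle *)

Section Fractions.
Context {R : realType} (A B C : R).

Lemma reduced_fraction_inj (p p' : int * int) : 1 <= p.2 -> 1 <= p'.2 ->
  gcdz p.1 p.2 = 1 -> gcdz p'.1 p'.2 = 1 ->
  p.1%:~R / p.2%:~R = p'.1%:~R / p'.2%:~R :> R -> p = p'.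
Proof.
case: p p' => [m n] [m' n'] /= n1 n'1 g1 g1' E.
have n0 : n != 0 by lia.
have n0' : n' != 0 by lia.
have E' : m * n' = m' * n.
  apply: (@intr_inj R); rewrite !rmorphM/=; move/eqP: E.
  by rewrite eqr_div ?intr_eq0// => /eqP.
have nn' : (n %| n')%Z.
  have : (n %| m * n')%Z by rewrite E' dvdz_mull.
  by rewrite Gauss_dvdzr// /coprimez gcdzC g1.
have n'n : (n' %| n)%Z.
  have : (n' %| m' * n)%Z by rewrite -E' dvdz_mull.
  by rewrite Gauss_dvdzr// /coprimez gcdzC g1'.
have nE : n = n'.
  have : (absz n == absz n')%N by rewrite eqn_dvd; apply/andP.
  by move=> /eqP; lia.
by congr pair => //; apply: (mulIf n0); rewrite -E' nE.
Qed.

(** Elements of [W] are real, so passing to the real part of J loses none of them; the positivity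
    that [W] demands comes from J lying in the positive interval. *)
Lemma ncard_W (J : set (projR R)) Delta : arc A B C (Some @^-1` J) ->
  J `<=` pos_interval A B C -> 0 < Delta ->
  ncard (J `&` W A B C Delta) =
  card_set (primitive A B C (Some @^-1` J) (Num.sqrt Delta)).
Proof.
move=> aS JI D0; have s0 : 0 < Num.sqrt Delta by rewrite sqrtr_gt0.
pose h (p : int * int) : projR R := Some (p.1%:~R / p.2%:~R).
have -> : J `&` W A B C Delta = h @` primitive A B C (Some @^-1` J) (Num.sqrt Delta).
  apply/seteqP; split.
    move=> x [Jx [m [n [n1 g /andP[_ Q] xE]]]]; rewrite {x}xE in Jx *.
    by exists (m, n) => //; split => //; split => //; rewrite /= sqr_sqrtr// ltW.
  move=> _ [[m n] [[/= n1 Jmn Q] /= g] <-]; split => //; exists m, n; split => //.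
  rewrite sqr_sqrtr ?(ltW D0)// in Q.
  apply/andP; split; last exact: Q.
  have n0 : n != 0 by lia.
  rewrite -[X in 0 < X]/(form A B C (m, n)) form_quad//= mulr_gt0//.
    by rewrite exprn_even_gt0//= intr_eq0.
  exact: JI Jmn.
rewrite -[LHS]/(card_set _) card_set_image//.
  exact: finite_setIl (finite_lattice aS s0).
by move=> p p' /set_mem[[p1 _ _] g] /set_mem[[p1' _ _] g'] [E]; exact: reduced_fraction_inj E.
Qed.

Lemma subinterval_arc (J : set (projR R)) : compact_subinterval J ->
  J `<=` pos_interval A B C -> arc A B C (Some @^-1` J).
Proof.
move=> [cJ kJ] JI; split; first exact: compact_coercive.
have [hN hY] := connected_interval kJ.
have [JN|JN] := pselect (J None); last by left; exact: hN.
(* When oo lies in J, the convention at oo yields 0 < A. *)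
by right; split; [exact: JI JN|exact: hY].
Qed.

End Fractions.

Theorem theorem1p5 (R : realType) (A B C : R) (hAB : (A, B) <> (0%R, 0%R)) :
  equidistributed (W A B C) (pos_interval A B C) (mu A B C).
Proof.
move=> I1 I2 c1 c2 I12 I2I mu0; have I1I := subset_trans I12 I2I.
have a1 := subinterval_arc c1 I1I; have a2 := subinterval_arc c2 I2I.
have mS := arc_measurable a2.
have fin := @integrable_fin_num _ _ _ (@lebesgue_measure R) _ mS _ (integrable_quadV a2).
have m0 : 0 < mass A B C (Some @^-1` I2).
  rewrite fine_gt0//; apply/andP; split; last by move: fin; rewrite fin_numElt => /andP[].
  rewrite lt0e; apply/andP; split; first exact/eqP.
  apply: integral_ge0 => u /I2I /= qu; rewrite lee_fin invr_ge0; exact: ltW.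
rewrite -[fine (mu A B C I1)]/(mass A B C (Some @^-1` I1)).
rewrite -[fine (mu A B C I2)]/(mass A B C (Some @^-1` I2)).
apply/cvgrPdist_le => e e0.
have [T HT] := primitive_ratio a1 a2 (fun u => I12 (Some u)) m0 e0.
near=> D.
have D1 : Num.max 1 T ^+ 2 <= D by near: D; apply: nbhs_pinfty_ge; rewrite num_real.
have M1 : 1 <= Num.max 1 T by rewrite le_max lexx.
have D0 : 0 < D by apply: lt_le_trans D1; rewrite exprn_gt0// (lt_le_trans _ M1).
rewrite !ncard_W//; apply: HT; apply: (@le_trans _ _ (Num.max 1 T)).
  by rewrite le_max lexx orbT.
by rewrite -[leLHS]ger0_norm ?(le_trans _ M1)// -sqrtr_sqr ler_wsqrtr.
Unshelve. all: by end_near. Qed.
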